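(* Consider the system $x(k+1)=A_0x(k)+A_1x(k-h_1)+Bu(k-h_2)$ with unknown constant matrices $A_0,A_1\in\mathbb{R}^{n\times n}$, $B\in\mathbb{R}^{n\times m}$, and with perturbed recorded data sequences $x=x^{\mathrm{nom}}+x^{\delta}$, $u=u^{\mathrm{nom}}+u^{\delta}$ on $\{-\bar h,\dots,T\}$ as described in the context. Let the integer $\bar h>0$ be the upper bound for the constant but unknown state and input delays $h_1\in\mathbb{Z}_{\ge0}$ and $h_2\in\mathbb{Z}_{\ge0}$. Build the matrices $$W_{0,(i,j)}=\begin{bmatrix}U_{i,\{0\}}\\ X_{j,\{0\}}\\ X_{\{0\}}\end{bmatrix},\qquad i,j\in\{0,1,\dots,\bar h\},$$ and suppose that, for all such $i$ and $j$, with $W^{\mathrm{nom}}_{0,(i,j)}$, $W^{\delta}_{0,(i,j)}$, $W^{\delta,11}_{0,(i,j)}$, $W^{\delta,12}_{0,(i,j)}$ as in the context, $$\mathrm{rank}(W_{0,(i,j)})=\mathrm{rank}(W^{\mathrm{nom}}_{0,(i,j)})=m+2n,\qquad \big\|W^{\delta,11}_{0,(i,j)}\big\|_2\big\|W_{0,(i,j)}^{\dagger}\big\|_2<1.$$ Furthermore, suppose that positive constants $r_{X^\delta_{\{1\}}}$, $r_{W^{\delta,11}_{0,(i,j)}}$, $r_{W^{\delta,12}_{0,(i,j)}}$ are known such that $$\|X^\delta_{\{1\}}\|_2\le r_{X^\delta_{\{1\}}},\quad \|W^{\delta,12}_{0,(i,j)}\|_2\le r_{W^{\delta,12}_{0,(i,j)}},\quad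 \|W^{\delta,11}_{0,(i,j)}\|_2\|W^{\dagger}_{0,(i,j)}\|_2\le r_{W^{\delta,11}_{0,(i,j)}}\|W^{\dagger}_{0,(i,j)}\|_2<1.$$ Let $d_{(i,j)}(X_{\{1\}})=\big\|X_{\{1\}}\big(I_T-W_{0,(i,j)}^{\dagger}W_{0,(i,j)}\big)\big\|_2$ and $\psi(\sigma)=\sigma/\sqrt{1+\sigma^2}$ for $\sigma\ge0$. If $$d_{(i^\star,j^\star)}\big(X_{\{1\}}\big)\le r_{X^\delta_{\{1\}}}+\big(\|X_{\{1\}}\|_2+r_{X^\delta_{\{1\}}}\big)\,\psi(\sigma^\star),\qquad \sigma^\star=\frac{r_{W^{\delta,12}_{0,(i^\star,j^\star)}}\|W^\dagger_{0,(i^\star,j^\star)}\|_2}{1-r_{W^{\delta,11}_{0,(i^\star,j^\star)}}\|W^\dagger_{0,(i^\star,j^\star)}\|_2},\qquad(\ast)$$ holds for only one pair $(i^\star,j^\star)\in\{0,\dots,\bar h\}^2$, then $h_1=j^\star$ and $h_2=i^\star$. Moreover, the corresponding open- and closed-loop data-based representations are obtained by using the matrices $U_{i^\star,\{0\}}$, $X_{j^\star,\{0\}}$ together with $X_{\{0\}}$ and $X_{\{1\}}$ in the formulas given in the context. If condition $(\ast)$ holds for two or more pairs $(i,j)$, then the delays are not decidable from the available data (the criterion leaves more than one candidate pair).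
   Context: Data: for $k=-\bar h,\dots,T$, with $T>\bar h$, the recorded sequences are $x(k)=x^{\mathrm{nom}}(k)+x^\delta(k)\in\mathbb{R}^n$, $u(k)=u^{\mathrm{nom}}(k)+u^\delta(k)\in\mathbb{R}^m$, where the nominal part satisfies $x^{\mathrm{nom}}(k+1)=A_0x^{\mathrm{nom}}(k)+A_1x^{\mathrm{nom}}(k-h_1)+Bu^{\mathrm{nom}}(k-h_2)$, $k=0,\dots,T-1$, with the true constant delays $h_1,h_2\in\{0,\dots,\bar h\}$, and the superscript $\delta$ denotes measurement noise. Data matrices: $U_{i,\{0\}}=[u(-i)\ \cdots\ u(T-1-i)]$, $X_{j,\{0\}}=[x(-j)\ \cdots\ x(T-1-j)]$, $X_{\{0\}}=[x(0)\ \cdots\ x(T-1)]$, $X_{\{1\}}=[x(1)\ \cdots\ x(T)]$. Superscripts nom and $\delta$ on these matrices, or on $W_{0,(i,j)}$, denote the same matrices built from the nominal and the noise sequences respectively, so that $W_{0,(i,j)}=W^{\mathrm{nom}}_{0,(i,j)}+W^\delta_{0,(i,j)}$ and $X_{\{1\}}=X_{\{1\}}^{\mathrm{nom}}+X_{\{1\}}^{\delta}$. $^\dagger$ is the Moore-Penrose inverse and $\|\cdot\|_2$ the induced Euclidean (spectral) norm. Factorization: for each $(i,j)$ let $U\in\mathbb{R}^{(m+2n)\times(m+2n)}$ and $V\in\mathbb{R}^{T\times T}$ be orthogonal matrices adapted to $W_{0,(i,j)}$ ($U$ spans $\mathrm{Range}(W_{0,(i,j)})$, and the first $m+2n$ columns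 of $V$ span $\mathrm{Range}(W_{0,(i,j)}^\top)$), so that $$W_{0,(i,j)}=U\begin{bmatrix}W^{11}_{0,(i,j)} & 0\end{bmatrix}V^\top,\qquad W^\delta_{0,(i,j)}=U\begin{bmatrix}W^{\delta,11}_{0,(i,j)} & W^{\delta,12}_{0,(i,j)}\end{bmatrix}V^\top,$$ with $W^{11}_{0,(i,j)},W^{\delta,11}_{0,(i,j)}\in\mathbb{R}^{(m+2n)\times(m+2n)}$ and $W^{\delta,12}_{0,(i,j)}\in\mathbb{R}^{(m+2n)\times(T-m-2n)}$. Here $\|W^\dagger_{0,(i,j)}\|_2=\|(W^{11}_{0,(i,j)})^{-1}\|_2$. Data-based representation formulas: with $W_0=W_{0,(i^\star,j^\star)}$, $h_2=i^\star$, $h_1=j^\star$, the open-loop data-based representation is $x(k+1)=X_{\{1\}}W_0^\dagger\,[u^\top(k-h_2)\ \ x^\top(k-h_1)\ \ x^\top(k)]^\top$; for feedback $u(k)=Kx(k)$, $K\in\mathbb{R}^{m\times n}$, the closed-loop data-based representation is $x(k+1)=X_{\{1\}}G_K\,[x^\top(k-h_2)\ \ x^\top(k-h_1)\ \ x^\top(k)]^\top$, where $G_K\in\mathbb{R}^{T\times3n}$ satisfies $\mathrm{diag}(K,I_n,I_n)=W_0G_K$, and $u(k)=U_{i^\star,\{0\}}G_K[I_n\ 0\ 0]^\top x(k)$. *)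

(* Defs.v *)
From HB Require Import structures.
From mathcomp Require Import all_boot all_order all_algebra.
From mathcomp Require Import boolp classical_sets reals.

Set Implicit Arguments.
Unset Strict Implicit.
Unset Printing Implicit Defensive.

Import Order.TTheory GRing.Theory Num.Theory.

Local Open Scope ring_scope.

Definition norm2 (R : realType) (p : nat) (v : 'cV[R]_p) : R :=
  Num.sqrt (\sum_i v i ord0 ^+ 2).

Definition opnorm2 (R : realType) (p q : nat) (A : 'M[R]_(p, q)) : R :=
  sup [set norm2 (A *m v) | v in [set v : 'cV[R]_q | norm2 v <= 1]]%classic.

Definition is_mpinv (R : realType) (p q : nat)
    (A : 'M[R]_(p, q)) (X : 'M[R]_(q, p)) : Prop :=
  [/\ A *m X *m A = A, X *m A *m X = X,
      (A *m X)^T = A *m X & (X *m A)^T = X *m A].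

(* The default value 0 is never used, see mpinvP.  The pinvmx of MathComp is
   only a generalized inverse, not the Moore-Penrose one. *)
Definition mpinv (R : realType) (p q : nat) (A : 'M[R]_(p, q)) : 'M[R]_(q, p) :=
  xget 0 [set X | is_mpinv A X]%classic.

Lemma gram_unitmx (R : realType) (p q : nat) (F : 'M[R]_(p, q)) :
  row_free F -> F *m F^T \in unitmx.
Proof.
move=> freeF; rewrite -row_free_unit; apply/row_freeP.
suff ker0 : kermx (F *m F^T) = 0.
  by apply/row_freeP; rewrite -kermx_eq0 ker0.
apply/eqP/rowV0P => v /sub_kermxP vFF.
have vF0 : v *m F = 0.
  have : (v *m F) *m (v *m F)^T = 0.
    by rewrite trmx_mul mulmxA -(mulmxA v) vFF mul0mx.
  move=> /matrixP/(_ ord0 ord0); rewrite !mxE => s0.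
  have s0' : \sum_j (v *m F) ord0 j ^+ 2 = 0.
    by rewrite -[RHS]s0; apply: eq_bigr => j _; rewrite [_^T _ _]mxE expr2.
  apply/rowP => j; rewrite [RHS]mxE; apply/eqP; rewrite -sqrf_eq0.
  move/eqP: s0'; rewrite psumr_eq0; last by move=> i _; exact: sqr_ge0.
  by move=> /allP/(_ j); rewrite mem_index_enum => /(_ isT).
by apply: (row_free_inj freeF); rewrite vF0 mul0mx.
Qed.

Lemma mpinvP (R : realType) (p q : nat) (A : 'M[R]_(p, q)) :
  is_mpinv A (mpinv A).
Proof.
suff [X AX] : exists X, is_mpinv A X by apply: (xgetPex 0); exists X.
have [r [C [F [-> freeF freeC]]]] :
    exists r (C : 'M[R]_(p, r)) (F : 'M[R]_(r, q)),
    [/\ A = C *m F, row_free F & row_free C^T].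
  exists (\rank A), (col_base A), (row_base A); split.
  - by rewrite mulmx_base.
  - exact: row_base_free.
  - by rewrite /row_free mxrank_tr; exact: col_base_full.
have uF := gram_unitmx freeF.
have := gram_unitmx freeC; rewrite trmxK => uC.
set iF := invmx (F *m F^T); set iC := invmx (C^T *m C).
have FK : F *m F^T *m iF = 1%:M by rewrite mulmxV.
have CK : iC *m (C^T *m C) = 1%:M by rewrite mulVmx.
pose X := F^T *m iF *m (iC *m C^T).
have eAX : C *m F *m X = C *m iC *m C^T.
  by rewrite /X !mulmxA -(mulmxA C F) -(mulmxA C _ iF) FK mulmx1.
have eXA : X *m (C *m F) = F^T *m iF *m F.
  by rewrite /X -!mulmxA (mulmxA C^T) (mulmxA iC) CK mul1mx.
have siF : iF^T = iF by rewrite /iF trmx_inv trmx_mul trmxK.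
have siC : iC^T = iC by rewrite /iC trmx_inv trmx_mul trmxK.
exists X; split.
- by rewrite eAX -!mulmxA (mulmxA C^T) (mulmxA iC) CK mul1mx.
- rewrite eXA /X -!mulmxA (mulmxA F) (mulmxA (F *m F^T)) FK.
  by rewrite mul1mx.
- by rewrite eAX !trmx_mul trmxK siC mulmxA.
- by rewrite eXA !trmx_mul trmxK siF mulmxA.
Qed.

Definition stack3 (R : realType) (p q s c : nat)
    (a : 'M[R]_(p, c)) (b : 'M[R]_(q, c)) (d : 'M[R]_(s, c)) :
    'M[R]_(p + (q + s), c) :=
  col_mx a (col_mx b d).

(* [s(a) s(a+1) ... s(a+T-1)] *)
Definition data_mx (R : realType) (p : nat) (T : nat)
    (s : int -> 'cV[R]_p) (a : int) : 'M[R]_(p, T) :=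
  \matrix_(r < p, c < T) s (c%:Z + a) r ord0.

Definition W0 (R : realType) (n m T : nat)
    (x : int -> 'cV[R]_n) (u : int -> 'cV[R]_m) (i j : nat) :
    'M[R]_(m + (n + n), T) :=
  stack3 (data_mx T u (- i%:Z)) (data_mx T x (- j%:Z)) (data_mx T x 0).

Definition system_step (R : realType) (n m : nat)
    (A0 A1 : 'M[R]_n) (B : 'M[R]_(n, m)) (h1 h2 : nat)
    (x : int -> 'cV[R]_n) (u : int -> 'cV[R]_m) (k : int) : Prop :=
  x (k + 1) = A0 *m x k + A1 *m x (k - h1%:Z) + B *m u (k - h2%:Z).

Definition system_traj (R : realType) (n m : nat)
    (A0 A1 : 'M[R]_n) (B : 'M[R]_(n, m)) (h1 h2 : nat)
    (x : int -> 'cV[R]_n) (u : int -> 'cV[R]_m) : Prop :=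
  forall k : nat, system_step A0 A1 B h1 h2 x u k%:Z.

(* The square factor V has its columns indexed by r + (T - r), so that its two
   column blocks, hence the blocks 11 and 12, are lsubmx and rsubmx; the two
   orthogonality equations force r <= T, hence r + (T - r) = T. *)
Definition blk11 (R : realType) (r T : nat)
    (U : 'M[R]_r) (V : 'M[R]_(T, r + (T - r))) (M : 'M[R]_(r, T)) : 'M[R]_r :=
  lsubmx (U^T *m M *m V).

Definition blk12 (R : realType) (r T : nat)
    (U : 'M[R]_r) (V : 'M[R]_(T, r + (T - r))) (M : 'M[R]_(r, T)) :
    'M[R]_(r, T - r) :=
  rsubmx (U^T *m M *m V).

(* mxalgebra compares row spaces, hence the transposes in the last two
   clauses: Range U = Range W, and Range V_1 = Range W^T. *)
Definition adapted (R : realType) (r T : nat) (W : 'M[R]_(r, T))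
    (U : 'M[R]_r) (V : 'M[R]_(T, r + (T - r))) : Prop :=
  [/\ U^T *m U = 1%:M /\ U *m U^T = 1%:M,
      V^T *m V = 1%:M /\ V *m V^T = 1%:M,
      W = U *m row_mx (blk11 U V W) 0 *m V^T,
      (U^T == W^T)%MS
    & ((lsubmx V)^T == W)%MS].

Definition psi (R : realType) (s : R) : R := s / Num.sqrt (1 + s ^+ 2).

Definition ddist (R : realType) (r n T : nat)
    (W : 'M[R]_(r, T)) (X : 'M[R]_(n, T)) : R :=
  opnorm2 (X *m (1%:M - mpinv W *m W)).

Definition sigma_star (R : realType) (r T : nat)
    (W : 'M[R]_(r, T)) (r11 r12 : R) : R :=
  r12 * opnorm2 (mpinv W) / (1 - r11 * opnorm2 (mpinv W)).

Definition delay_test (R : realType) (n m T : nat)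
    (x : int -> 'cV[R]_n) (u : int -> 'cV[R]_m) (rX r11 r12 : R)
    (i j : nat) : bool :=
  let X1 := data_mx T x 1 in
  let W := W0 T x u i j in
  ddist W X1 <= rX + (opnorm2 X1 + rX) * psi (sigma_star W r11 r12).

(* P is the set of pairs (i, j) under test; P = [rel _ _ | true] tests all of
   {0, ..., hbar}^2.  That choice cannot meet the rank conditions when n > 0,
   because W0 repeats the rows of X_{0} for j = 0 (rank_W0_nodelay); a
   smaller P, e.g. [rel _ j | 0 < j], can. *)
Definition candidate (R : realType) (n m T hbar : nat)
    (P : rel 'I_hbar.+1) (x : int -> 'cV[R]_n) (u : int -> 'cV[R]_m)
    (rX : R) (r11 r12 : 'I_hbar.+1 -> 'I_hbar.+1 -> R)
    (i j : 'I_hbar.+1) : bool :=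
  P i j && delay_test T x u rX (r11 i j) (r12 i j) i j.

Definition only_candidate (hbar : nat) (C : rel 'I_hbar.+1)
    (i j : 'I_hbar.+1) : Prop :=
  C i j /\ forall i' j', C i' j' -> i' = i /\ j' = j.

Lemma rank_W0_nodelay (R : realType) (n m T : nat)
    (x : int -> 'cV[R]_n) (u : int -> 'cV[R]_m) (i : nat) :
  (\rank (W0 T x u i 0) <= m + n)%N.
Proof.
set X := data_mx T x 0; set Ui := data_mx T u (- i%:Z).
have sub : (W0 T x u i 0 <= col_mx Ui X)%MS.
  rewrite /W0 /stack3 oppr0 !col_mx_sub -/X -/Ui -!addsmxE.
  by rewrite addsmxSl !addsmxSr.
exact: leq_trans (mxrankS sub) (rank_leq_row _).
Qed.

Definition open_loop_dbr (R : realType) (n m T : nat)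
    (X1 : 'M[R]_(n, T)) (W : 'M[R]_(m + (n + n), T)) (i j : nat)
    (x : int -> 'cV[R]_n) (u : int -> 'cV[R]_m) : Prop :=
  forall k : nat, x (k%:Z + 1) =
    X1 *m mpinv W *m stack3 (u (k%:Z - i%:Z)) (x (k%:Z - j%:Z)) (x k%:Z).

Definition closed_loop_dbr (R : realType) (n T : nat)
    (X1 : 'M[R]_(n, T)) (G : 'M[R]_(T, n + (n + n))) (i j : nat)
    (x : int -> 'cV[R]_n) : Prop :=
  forall k : nat, x (k%:Z + 1) =
    X1 *m G *m stack3 (x (k%:Z - i%:Z)) (x (k%:Z - j%:Z)) (x k%:Z).

(* diag(K, I_n, I_n) *)
Definition diagK (R : realType) (n m : nat) (K : 'M[R]_(m, n)) :
    'M[R]_(m + (n + n), n + (n + n)) :=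
  block_mx K 0 0 1%:M.

(* X_{1}^delta - [B A1 A0] W_0^delta: the part of X_{1} that noise adds to
   [B A1 A0] W_0.  The data-based formulas built on X_{1} are exact for the
   system up to this term, and exact when it vanishes. *)
Definition noise_residual (R : realType) (n m T : nat)
    (A0 A1 : 'M[R]_n) (B : 'M[R]_(n, m))
    (xd : int -> 'cV[R]_n) (ud : int -> 'cV[R]_m) (i j : nat) : 'M[R]_(n, T) :=
  data_mx T xd 1 - row_mx B (row_mx A1 A0) *m W0 T xd ud i j.

(* Main.v *)
(* It suffices that the true pair always passes the test; everything else is
   bookkeeping on candidates and the identity [W W^+ = 1].  For the true pair,
   [X_1 = M (W - Wd) + Xd] with [M = [B A1 A0]].  With [Q = 1 - W^+ W] the
   orthogonal projector on the kernel of [W], [|Xd Q| <= rX], and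
   [|M (W - Wd) Q| <= psi(sigma) |M (W - Wd)|] because every vector in the row
   space of [W - Wd] makes an angle at most [atan sigma] with the row space of
   [W], and [psi = sin o atan]. *)
Require Import Defs.
From HB Require Import structures.
From mathcomp Require Import all_boot all_order all_algebra.
From mathcomp Require Import boolp classical_sets reals.
From mathcomp Require Import ring lra zify.

Set Implicit Arguments.
Unset Strict Implicit.
Unset Printing Implicit Defensive.

Import Order.TTheory GRing.Theory Num.Theory.

Local Open Scope ring_scope.


(** * Euclidean and spectral norms, and the function [psi] *)

Section EuclideanNorm.
Variable R : realType.

Definition dotc (p : nat) (u v : 'cV[R]_p) : R := (u^T *m v) ord0 ord0.

Lemma dotcE (p : nat) (u v : 'cV[R]_p) :
  dotc u v = \sum_i u i ord0 * v i ord0.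
Proof. by rewrite /dotc mxE; apply: eq_bigr => i _; rewrite mxE. Qed.

Lemma norm2_ge0 (p : nat) (v : 'cV[R]_p) : 0 <= norm2 v.
Proof. exact: sqrtr_ge0. Qed.

Lemma sqr_norm2 (p : nat) (v : 'cV[R]_p) : norm2 v ^+ 2 = dotc v v.
Proof.
rewrite /norm2 sqr_sqrtr; last by apply: sumr_ge0 => i _; exact: sqr_ge0.
by rewrite dotcE; apply: eq_bigr => i _; rewrite expr2.
Qed.

Lemma dotcC (p : nat) (u v : 'cV[R]_p) : dotc u v = dotc v u.
Proof. by rewrite !dotcE; apply: eq_bigr => i _; rewrite mulrC. Qed.

Lemma dotcDr (p : nat) (u v w : 'cV[R]_p) :
  dotc u (v + w) = dotc u v + dotc u w.
Proof. by rewrite /dotc mulmxDr mxE. Qed.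

Lemma dotcZr (p : nat) a (u v : 'cV[R]_p) : dotc u (a *: v) = a * dotc u v.
Proof. by rewrite /dotc -scalemxAr mxE. Qed.

Lemma dotcDl (p : nat) (u v w : 'cV[R]_p) :
  dotc (u + v) w = dotc u w + dotc v w.
Proof. by rewrite dotcC dotcDr !(dotcC w). Qed.

Lemma dotcZl (p : nat) a (u v : 'cV[R]_p) : dotc (a *: u) v = a * dotc u v.
Proof. by rewrite dotcC dotcZr dotcC. Qed.

Lemma dotc_mulmx (p q : nat) (A : 'M[R]_(p, q)) (u : 'cV[R]_p)
    (v : 'cV[R]_q) :
  dotc u (A *m v) = dotc (A^T *m u) v.
Proof. by rewrite /dotc trmx_mul trmxK mulmxA. Qed.

Lemma norm2_eq0 (p : nat) (v : 'cV[R]_p) : norm2 v = 0 -> v = 0.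
Proof.
move=> v0; have := sqr_norm2 v; rewrite v0 expr0n /= dotcE => /esym/eqP.
rewrite psumr_eq0 => [/allP s0|i _]; last by rewrite -expr2 sqr_ge0.
apply/colP => i; rewrite mxE; apply/eqP.
by have := s0 i (mem_index_enum i); rewrite mulf_eq0 orbb.
Qed.

Lemma norm20 (p : nat) : norm2 (0 : 'cV[R]_p) = 0.
Proof.
by rewrite /norm2 big1 ?sqrtr0 // => i _; rewrite mxE expr0n.
Qed.

Lemma norm2Z (p : nat) a (v : 'cV[R]_p) : norm2 (a *: v) = `|a| * norm2 v.
Proof.
apply/eqP; rewrite -(@eqrXn2 _ 2) ?mulr_ge0 ?norm2_ge0 //.
by rewrite exprMn !sqr_norm2 dotcZr dotcZl mulrA -expr2 real_normK ?num_real.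
Qed.

Lemma norm2N (p : nat) (v : 'cV[R]_p) : norm2 (- v) = norm2 v.
Proof. by rewrite -scaleN1r norm2Z normrN1 mul1r. Qed.

(** Cauchy-Schwarz: the squared norm of [norm2 v ^+ 2 *: u - dotc u v *: v] is nonnegative, and it
    equals [norm2 v ^+ 2] times the gap between the squares of the two sides. *)
Lemma dotc_le (p : nat) (u v : 'cV[R]_p) : dotc u v <= norm2 u * norm2 v.
Proof.
have [v0|v0] := eqVneq (norm2 v) 0.
  by rewrite v0 mulr0 (norm2_eq0 v0) /dotc mulmx0 mxE.
have cgt0 : 0 < norm2 v ^+ 2 by rewrite exprn_gt0 // lt_def v0 norm2_ge0.
apply: le_trans (ler_norm _) _.
rewrite -(@ler_pXn2r _ 2) ?nnegrE ?mulr_ge0 ?norm2_ge0 //.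
rewrite real_normK ?num_real // exprMn -(ler_pM2l cgt0) -subr_ge0.
have := sqr_ge0 (norm2 (norm2 v ^+ 2 *: u + (- dotc u v) *: v)).
rewrite [norm2 (_ + _) ^+ 2]sqr_norm2 dotcDr !dotcDl !dotcZr !dotcZl.
rewrite (dotcC v u) -!sqr_norm2.
by congr (0 <= _); ring.
Qed.

Lemma norm2D (p : nat) (u v : 'cV[R]_p) : norm2 (u + v) <= norm2 u + norm2 v.
Proof.
rewrite -(@ler_pXn2r _ 2) ?nnegrE ?addr_ge0 ?norm2_ge0 //.
rewrite [norm2 (_ + _) ^+ 2]sqr_norm2 dotcDr !dotcDl -!sqr_norm2.
have := dotc_le u v; rewrite (dotcC v u); nra.
Qed.

Lemma norm2_isometry (p q : nat) (A : 'M[R]_(p, q)) (v : 'cV[R]_q) :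
  A^T *m A = 1%:M -> norm2 (A *m v) = norm2 v.
Proof.
move=> AA; apply/eqP; rewrite -(@eqrXn2 _ 2) ?norm2_ge0 // !sqr_norm2.
by rewrite dotc_mulmx mulmxA AA mul1mx.
Qed.

(** For an orthogonal projector, [dotc (A *m v) v] is the square of [norm2 (A *m v)]; Cauchy-Schwarz
    then leaves one factor to cancel. *)
Lemma norm2_proj (p : nat) (A : 'M[R]_p) (v : 'cV[R]_p) :
  A^T = A -> A *m A = A -> norm2 (A *m v) <= norm2 v.
Proof.
move=> sA AA; have := dotc_le (A *m v) v.
have -> : dotc (A *m v) v = norm2 (A *m v) * norm2 (A *m v).
  by rewrite -expr2 sqr_norm2 dotc_mulmx sA mulmxA AA.
have [->|n0] := eqVneq (norm2 (A *m v)) 0; first by rewrite norm2_ge0.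
by rewrite ler_pM2l // lt_def n0 norm2_ge0.
Qed.

(** The [sup] defining [opnorm2] is meaningful only for a nonempty bounded set, so the bounds on
    [opnorm2] below go through this lemma. *)
Lemma opnorm2_has_sup (p q : nat) (A : 'M[R]_(p, q)) :
  has_sup [set norm2 (A *m v) | v in [set v : 'cV[R]_q | norm2 v <= 1]]%classic.
Proof.
split; first by exists (norm2 (A *m 0)), 0; rewrite //= norm20.
(* The upper bound is the Frobenius norm, and Cauchy-Schwarz is applied row by row. *)
exists (Num.sqrt (\sum_i norm2 (row i A)^T ^+ 2)) => _ [v /= v1 <-].
apply: ler_wsqrtr; apply: ler_sum => i _.
have -> : (A *m v) i ord0 = dotc (row i A)^T v.
  by rewrite /dotc trmxK -row_mul [RHS]mxE.
rewrite -[dotc _ _ ^+ 2]real_normK ?num_real // ler_pXn2r ?nnegrE ?norm2_ge0 //.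
have vle w : norm2 w <= 1 -> dotc (row i A)^T w <= norm2 (row i A)^T.
  by move=> w1; rewrite (le_trans (dotc_le _ _)) // ler_piMr ?norm2_ge0.
rewrite ler_norml vle // andbT lerNl -mulN1r -dotcZr.
by rewrite vle // norm2Z normrN1 mul1r.
Qed.

Lemma opnorm2_ge0 (p q : nat) (A : 'M[R]_(p, q)) : 0 <= opnorm2 A.
Proof.
apply: le_trans (norm2_ge0 (A *m 0)) _.
apply: ub_le_sup; first by case: (opnorm2_has_sup A).
by exists 0; rewrite //= norm20.
Qed.

Lemma norm2_mulmx (p q : nat) (A : 'M[R]_(p, q)) (v : 'cV[R]_q) :
  norm2 (A *m v) <= opnorm2 A * norm2 v.
Proof.
have [v0|v0] := eqVneq (norm2 v) 0.
  by rewrite v0 mulr0 (norm2_eq0 v0) mulmx0 norm20.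
have vgt0 : 0 < norm2 v by rewrite lt_def v0 norm2_ge0.
have nZ (p' : nat) (w : 'cV[R]_p') :
    norm2 ((norm2 v)^-1 *: w) = (norm2 v)^-1 * norm2 w.
  by rewrite norm2Z ger0_norm // invr_ge0 norm2_ge0.
rewrite mulrC -ler_pdivrMl // -nZ scalemxAr.
apply: ub_le_sup; first by case: (opnorm2_has_sup A).
by exists ((norm2 v)^-1 *: v); rewrite //= nZ mulVf.
Qed.

Lemma opnorm2_le (p q : nat) (A : 'M[R]_(p, q)) c :
  0 <= c -> (forall v, norm2 (A *m v) <= c * norm2 v) -> opnorm2 A <= c.
Proof.
move=> c0 Ac; apply: ge_sup; first by case: (opnorm2_has_sup A).
move=> _ [v /= v1 <-]; apply: le_trans (Ac v) _.
by rewrite ler_piMr.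
Qed.

(** The square of [norm2 (A^T *m v)] is [dotc v (A *m (A^T *m v))], at most
    [norm2 v * opnorm2 A * norm2 (A^T *m v)]; one factor cancels. *)
Lemma opnorm2_tr_le (p q : nat) (A : 'M[R]_(p, q)) :
  opnorm2 A^T <= opnorm2 A.
Proof.
apply: opnorm2_le => [|v]; first exact: opnorm2_ge0.
have := dotc_le v (A *m (A^T *m v)).
rewrite dotc_mulmx -sqr_norm2 expr2.
have := norm2_mulmx A (A^T *m v); have := norm2_ge0 v.
have [->|n0] := eqVneq (norm2 (A^T *m v)) 0.
  by rewrite mulr_ge0 ?opnorm2_ge0 ?norm2_ge0.
have ngt0 : 0 < norm2 (A^T *m v) by rewrite lt_def n0 norm2_ge0.
move=> v0 h1 h2; rewrite -(ler_pM2l ngt0); apply: le_trans h2 _.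
have := ler_wpM2l v0 h1; lra.
Qed.

Lemma opnorm2_tr (p q : nat) (A : 'M[R]_(p, q)) : opnorm2 A^T = opnorm2 A.
Proof.
by apply/le_anti; rewrite opnorm2_tr_le -{1}[A]trmxK opnorm2_tr_le.
Qed.

Lemma opnorm2D (p q : nat) (A B : 'M[R]_(p, q)) :
  opnorm2 (A + B) <= opnorm2 A + opnorm2 B.
Proof.
apply: opnorm2_le => [|v]; first by rewrite addr_ge0 ?opnorm2_ge0.
by rewrite mulmxDl mulrDl (le_trans (norm2D _ _)) // lerD ?norm2_mulmx.
Qed.

Lemma opnorm2N (p q : nat) (A : 'M[R]_(p, q)) : opnorm2 (- A) = opnorm2 A.
Proof.
apply/le_anti/andP; split; apply: opnorm2_le; rewrite ?opnorm2_ge0 // => v.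
  by rewrite mulNmx norm2N norm2_mulmx.
by rewrite -norm2N -mulNmx norm2_mulmx.
Qed.

Lemma psi_ge0 (s : R) : 0 <= s -> 0 <= psi s.
Proof. by move=> s0; rewrite divr_ge0 // sqrtr_ge0. Qed.

(** In a right triangle with legs [a], [b] and hypotenuse [c], the angle opposite [b] has tangent at
    most [s], hence sine at most [psi s]. After squaring, the claim reduces to
    [b ^+ 2 <= (s * a) ^+ 2]. *)
Lemma le_psi (s a b c : R) : 0 <= s -> 0 <= b -> 0 <= c ->
  b <= s * a -> c ^+ 2 = a ^+ 2 + b ^+ 2 -> b <= psi s * c.
Proof.
move=> s0 b0 c0 bsa cE.
have q0 : 0 < 1 + s ^+ 2 by rewrite ltr_pwDl // sqr_ge0.
rewrite /psi mulrAC ler_pdivlMr ?sqrtr_gt0 //.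
rewrite -(@ler_pXn2r _ 2) ?nnegrE ?mulr_ge0 ?sqrtr_ge0 //.
rewrite !exprMn sqr_sqrtr ?(ltW q0) // cE.
have : b ^+ 2 <= (s * a) ^+ 2 by rewrite lerXn2r ?nnegrE // (le_trans b0).
rewrite exprMn; nra.
Qed.

End EuclideanNorm.

(** * The kernel projector of [W] and its effect on perturbed row spaces *)

Section RowSpaceAngle.
Variables (R : realType) (r T : nat).
Variable W : 'M[R]_(r, T).

Lemma mulmx_mpinv : row_free W -> W *m mpinv W = 1%:M.
Proof.
move=> /row_freeP[N WN]; have [WXW _ _ _] := mpinvP W.
by rewrite -[LHS]mulmx1 -WN mulmxA WXW.
Qed.

Lemma ker_proj_tr : (1%:M - mpinv W *m W)^T = 1%:M - mpinv W *m W.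
Proof. by have [_ _ _ sXW] := mpinvP W; rewrite linearB /= trmx1 sXW. Qed.

Lemma ker_projK :
  (1%:M - mpinv W *m W) *m (1%:M - mpinv W *m W) = 1%:M - mpinv W *m W.
Proof.
have [_ XWX _ _] := mpinvP W.
by rewrite mulmxBr mulmx1 mulmxBl mul1mx mulmxA XWX subrr subr0.
Qed.

Variables (U : 'M[R]_r) (V : 'M[R]_(T, r + (T - r))).
Hypothesis UV : adapted W U V.

Let V1 := lsubmx V.
Let V2 := rsubmx V.

(** The first three identities are the orthogonality of [V] read blockwise. The factorization of [W]
    has a zero second block, so [V2] is orthogonal to the rows of [W]; the columns of [mpinv W] lie
    in that row space, because the Penrose equations give [X = W^T *m X^T *m X]. *)
Lemma adapted_blocks :
  [/\ V1^T *m V1 = 1%:M, V2^T *m V2 = 1%:M, V1 *m V1^T + V2 *m V2^T = 1%:M,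
      V2^T *m W^T = 0 & V2^T *m mpinv W = 0].
Proof.
have [_ [VV VVt] WE _ _] := UV.
move: VV VVt; rewrite -[V]hsubmxK tr_row_mx mul_col_row mul_row_col.
rewrite scalar_mx_block => /eq_block_mx[V11 V12 V21 V22] VVt.
have V2V : V2^T *m V = row_mx 0 1%:M.
  by rewrite -[V]hsubmxK mul_mx_row V21 V22.
have V2W : V2^T *m W^T = 0.
  rewrite WE !trmx_mul trmxK !mulmxA V2V tr_row_mx trmx0 mul_row_col.
  by rewrite mul0mx mulmx0 addr0 mul0mx.
split=> //; have [_ XWX _ sXW] := mpinvP W.
by rewrite -XWX -sXW trmx_mul !mulmxA V2W !mul0mx.
Qed.

(** The projector fixes [V2], and it kills [V1] because the columns of [V1] are combinations of the
    rows of [W]. Inserting [V1 *m V1^T + V2 *m V2^T = 1%:M] concludes. *)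
Lemma adapted_ker_proj : 1%:M - mpinv W *m W = V2 *m V2^T.
Proof.
have [_ _ VV _ V2X] := adapted_blocks.
have V2Q : V2^T *m (1%:M - mpinv W *m W) = V2^T.
  by rewrite mulmxBr mulmx1 mulmxA V2X mul0mx subr0.
have QV1 : (1%:M - mpinv W *m W) *m V1 = 0.
  have [_ _ _ _ /andP[/submxP[N V1E] _]] := UV.
  have [WXW _ _ _] := mpinvP W.
  rewrite -[V1]trmxK V1E -ker_proj_tr -trmx_mul mulmxBr mulmx1.
  by rewrite -(mulmxA N) (mulmxA W) WXW subrr trmx0.
rewrite -[LHS]mulmx1; set Q := 1%:M - _ in V2Q QV1 *.
rewrite -VV mulmxDr mulmxA QV1 mul0mx add0r mulmxA.
by rewrite {1}/Q -ker_proj_tr -/Q -[_ *m V2]trmxK trmx_mul trmxK V2Q trmxK.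
Qed.

(* The rows of [W - Wd] make an angle with those of [W] whose tangent is at
   most sigma: in the basis [V1, V2], [p := (W - Wd)^T z] has second component
   [- Wd12^T U^T z], while applying [(W^+)^T] to [p] recovers [z] up to
   [|Wd11| |W^+| |z|], so that [|z|] is controlled by the first component. *)
Lemma norm2_ker_proj (Wd : 'M[R]_(r, T)) (r11 r12 : R) (z : 'cV[R]_r) :
  row_free W -> 0 <= r12 ->
  opnorm2 (blk12 U V Wd) <= r12 ->
  opnorm2 (blk11 U V Wd) * opnorm2 (mpinv W) <= r11 * opnorm2 (mpinv W) < 1 ->
  norm2 ((1%:M - mpinv W *m W) *m ((W - Wd)^T *m z))
    <= psi (sigma_star W r11 r12) * norm2 ((W - Wd)^T *m z).
Proof.
move=> freeW r12_ge0 b12 /andP[b11 lt1].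
set X := mpinv W; set p := (W - Wd)^T *m z; set w := opnorm2 X in b11 lt1 *.
have w0 : 0 <= w := opnorm2_ge0 X.
have [V11 V22 VV V2W V2X] := adapted_blocks.
have [[_ UU] _ _ _ _] := UV.
have Uz : norm2 (U^T *m z) = norm2 z by apply: norm2_isometry; rewrite trmxK.
have D1 : V1^T *m Wd^T = (blk11 U V Wd)^T *m U^T.
  rewrite /blk11 -mulmx_lsub !trmx_mul trmxK -/V1.
  by rewrite -!mulmxA UU mulmx1.
have D2 : V2^T *m Wd^T = (blk12 U V Wd)^T *m U^T.
  rewrite /blk12 -mulmx_rsub !trmx_mul trmxK -/V2.
  by rewrite -!mulmxA UU mulmx1.
have XV2 : X^T *m V2 = 0 by rewrite -[V2]trmxK -trmx_mul V2X trmx0.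
(* The transposed pseudoinverse sees only the [V1] component of a vector, so [V2^T *m p] does not
   enter the recovery of [z]. *)
have XE : X^T = X^T *m V1 *m V1^T.
  by rewrite -[LHS]mulmx1 -VV mulmxDr !mulmxA XV2 mul0mx addr0.
have p2 : V2^T *m p = - ((blk12 U V Wd)^T *m (U^T *m z)).
  rewrite /p linearB /= mulmxA mulmxBr V2W sub0r D2.
  by rewrite mulNmx mulmxA.
have p2le : norm2 (V2^T *m p) <= r12 * norm2 z.
  rewrite p2 norm2N (le_trans (norm2_mulmx _ _)) // Uz opnorm2_tr.
  by rewrite ler_wpM2r ?norm2_ge0.
have XVV (q : 'cV[R]_T) : X^T *m (V1 *m (V1^T *m q)) = X^T *m q.
  by rewrite {2}XE !mulmxA.
(* This is [z = X^T *m (W^T *m z)] with [W^T *m z] split as [p + Wd^T *m z]. *)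
have zE : z = X^T *m (V1 *m (V1^T *m p))
              + X^T *m (V1 *m ((blk11 U V Wd)^T *m (U^T *m z))).
  rewrite (mulmxA _ U^T) -D1 -(mulmxA V1^T) !XVV -mulmxDr /p -mulmxDl -linearD.
  by rewrite subrK mulmxA -trmx_mul mulmx_mpinv // trmx1 mul1mx.
have zle : norm2 z <= w * norm2 (V1^T *m p) + r11 * w * norm2 z.
  rewrite {1}zE (le_trans (norm2D _ _)) // lerD //.
    rewrite (le_trans (norm2_mulmx _ _)) // opnorm2_tr.
    by rewrite norm2_isometry.
  rewrite (le_trans (norm2_mulmx _ _)) // opnorm2_tr norm2_isometry //.
  apply: (@le_trans _ _ (opnorm2 (blk11 U V Wd) * w * norm2 z)).
    rewrite [_ * w]mulrC -mulrA ler_wpM2l // (le_trans (norm2_mulmx _ _)) //.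
    by rewrite Uz opnorm2_tr.
  by rewrite ler_wpM2r ?norm2_ge0.
rewrite adapted_ker_proj.
have s0 : 0 < 1 - r11 * w by rewrite subr_gt0.
(* The legs are the [V1] and [V2] components of [p]. Solving [zle] for [norm2 z] yields the
   denominator [1 - r11 * w] of [sigma_star]; the factor [r12] comes from [p2le]. *)
apply: (@le_psi _ _ (norm2 (V1^T *m p))); rewrite ?norm2_ge0 //.
- by rewrite /sigma_star divr_ge0 ?mulr_ge0 // ltW.
- rewrite -mulmxA (norm2_isometry (V2^T *m p) V22) /sigma_star -/X -/w mulrAC.
  rewrite ler_pdivlMr //.
  apply: le_trans (ler_wpM2r (ltW s0) p2le) _.
  by rewrite -!mulrA ler_wpM2l //; lra.
- rewrite -mulmxA (norm2_isometry (V2^T *m p) V22) !sqr_norm2.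
  rewrite (dotc_mulmx V1^T _ p) (dotc_mulmx V2^T _ p) !trmxK -dotcDl.
  by rewrite (mulmxA V1) (mulmxA V2) -mulmxDl VV mul1mx.
Qed.

(** The projector does not enlarge the noise [Xd], which costs [rX], and it shrinks the nominal part
    by the factor [psi]. The norm of the nominal part is not measurable, so it is replaced by
    [opnorm2 X + rX]. *)
Lemma ddist_le (n : nat) (Wd : 'M[R]_(r, T)) (M : 'M[R]_(n, r))
    (Xd X : 'M[R]_(n, T)) (rX r11 r12 : R) :
  row_free W -> 0 <= r12 -> X = M *m (W - Wd) + Xd -> opnorm2 Xd <= rX ->
  opnorm2 (blk12 U V Wd) <= r12 ->
  opnorm2 (blk11 U V Wd) * opnorm2 (mpinv W) <= r11 * opnorm2 (mpinv W) < 1 ->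
  ddist W X <= rX + (opnorm2 X + rX) * psi (sigma_star W r11 r12).
Proof.
move=> freeW r12_ge0 XE bX b12 b11; set s := psi _.
have s0 : 0 <= s.
  have /andP[_ lt1] := b11; apply: psi_ge0.
  by rewrite divr_ge0 ?mulr_ge0 ?opnorm2_ge0 // subr_ge0 ltW.
have nomle : opnorm2 (M *m (W - Wd)) <= opnorm2 X + rX.
  have -> : M *m (W - Wd) = X + - Xd by rewrite XE addrK.
  by rewrite (le_trans (opnorm2D _ _)) // opnorm2N lerD2l.
rewrite /ddist {1}XE mulmxDl addrC; set Q := _ - _.
apply: le_trans (opnorm2D _ _) _; apply: lerD.
  apply: opnorm2_le => [|v]; first exact: le_trans (opnorm2_ge0 _) bX.
  rewrite -mulmxA (le_trans (norm2_mulmx _ _)) //.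
  rewrite ler_pM ?opnorm2_ge0 ?norm2_ge0 //.
  by apply: norm2_proj; [exact: ker_proj_tr | exact: ker_projK].
(* The angle estimate concerns combinations of rows of [W - Wd], written as columns; transposing
   puts the product in that form, with [z = M^T *m v]. *)
rewrite -opnorm2_tr trmx_mul ker_proj_tr -/Q.
apply: opnorm2_le => [|v].
  by rewrite mulr_ge0 // (le_trans (opnorm2_ge0 _) nomle).
rewrite trmx_mul -!mulmxA.
apply: le_trans (norm2_ker_proj (M^T *m v) freeW r12_ge0 b12 b11) _.
rewrite -/s (mulrC _ s) -(mulrA s) ler_wpM2l // mulmxA -trmx_mul.
by rewrite (le_trans (norm2_mulmx _ _)) // opnorm2_tr ler_wpM2r ?norm2_ge0.
Qed.

End RowSpaceAngle.

(** * Data matrices of the delay system and the data-based representations *)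

Section DelaySystem.
Variables (R : realType) (n m T : nat).
Variables (A0 A1 : 'M[R]_n) (B : 'M[R]_(n, m)).

Lemma row_mx_stack3 (c : nat) (a : 'M[R]_(m, c)) (b d : 'M[R]_(n, c)) :
  row_mx B (row_mx A1 A0) *m stack3 a b d = A0 *m d + A1 *m b + B *m a.
Proof. by rewrite /stack3 !mul_row_col addrC [A1 *m b + _]addrC. Qed.

Lemma system_stepE (h1 h2 : nat) (x : int -> 'cV[R]_n) (u : int -> 'cV[R]_m) k :
  system_step A0 A1 B h1 h2 x u k <->
  x (k + 1) = row_mx B (row_mx A1 A0)
                *m stack3 (u (k - h2%:Z)) (x (k - h1%:Z)) (x k).
Proof. by rewrite row_mx_stack3. Qed.

Lemma col_data_mx (p : nat) (s : int -> 'cV[R]_p) a (c : 'I_T) :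
  col c (data_mx T s a) = s (c%:Z + a).
Proof. by apply/colP => i; rewrite !mxE. Qed.

Lemma col_W0 (x : int -> 'cV[R]_n) (u : int -> 'cV[R]_m) i j (c : 'I_T) :
  col c (W0 T x u i j) = stack3 (u (c%:Z - i%:Z)) (x (c%:Z - j%:Z)) (x c%:Z).
Proof. by rewrite /W0 /stack3 !col_col_mx !col_data_mx addr0. Qed.

Lemma col_eq (p q : nat) (M N : 'M[R]_(p, q)) :
  (forall c, col c M = col c N) -> M = N.
Proof.
move=> MN; apply/matrixP => i c.
by have /colP/(_ i) := MN c; rewrite !mxE.
Qed.

Lemma data_mx_step (h1 h2 : nat) (x : int -> 'cV[R]_n) (u : int -> 'cV[R]_m) :
  (forall k : nat, (k < T)%N -> system_step A0 A1 B h1 h2 x u k%:Z) ->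
  data_mx T x 1 = row_mx B (row_mx A1 A0) *m W0 T x u h2 h1.
Proof.
move=> dyn; apply: col_eq => c.
rewrite col_data_mx colE -mulmxA -colE col_W0.
exact/system_stepE/dyn.
Qed.

Lemma data_mxD (p : nat) (s s' s'' : int -> 'cV[R]_p) a :
  (forall c : nat, (c < T)%N ->
     s (c%:Z + a) = s' (c%:Z + a) + s'' (c%:Z + a)) ->
  data_mx T s a = data_mx T s' a + data_mx T s'' a.
Proof.
by move=> sD; apply/matrixP => i c; rewrite !mxE sD // mxE.
Qed.

Lemma W0D (hbar : nat) (x x' x'' : int -> 'cV[R]_n) (u u' u'' : int -> 'cV[R]_m)
    (i j : 'I_hbar.+1) :
  (forall k : int, - hbar%:Z <= k <= T%:Z -> x k = x' k + x'' k) ->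
  (forall k : int, - hbar%:Z <= k <= T%:Z -> u k = u' k + u'' k) ->
  W0 T x u i j = W0 T x' u' i j + W0 T x'' u'' i j.
Proof.
(* The splitting is given only on the recorded window, so every shifted index must be shown to stay
   inside it. *)
move=> xD uD; have rng (c : nat) (h : 'I_hbar.+1) : (c < T)%N ->
    - hbar%:Z <= c%:Z - h%:Z <= T%:Z.
  by have := ltn_ord h; lia.
rewrite /W0 /stack3 !add_col_mx; congr (col_mx _ (col_mx _ _)).
- by apply: data_mxD => c cT; apply: uD; exact: rng.
- by apply: data_mxD => c cT; apply: xD; exact: rng.
- by apply: data_mxD => c cT; apply: xD; rewrite addr0; lia.
Qed.

(** Full row rank makes [mpinv W] a right inverse, so [X *m mpinv W] is exactly [[B A1 A0]] and both
    recursions have the same coefficients. Here [i] delays the input and [j] the state. *)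
Lemma system_traj_dbr (W : 'M[R]_(m + (n + n), T)) (X : 'M[R]_(n, T))
    (i j : nat) (x : int -> 'cV[R]_n) (u : int -> 'cV[R]_m) :
  row_free W -> X = row_mx B (row_mx A1 A0) *m W ->
  system_traj A0 A1 B j i x u <-> open_loop_dbr X W i j x u.
Proof.
move=> freeW ->; have WX := mulmx_mpinv freeW.
by split=> tr k; move: (tr k); rewrite system_stepE -(mulmxA _ W) WX mulmx1.
Qed.

Lemma diagK_stack3 (K : 'M[R]_(m, n)) (c : nat) (a b d : 'M[R]_(n, c)) :
  diagK K *m stack3 a b d = stack3 (K *m a) b d.
Proof.
by rewrite /diagK /stack3 mul_block_col !mul0mx addr0 add0r mul1mx.
Qed.

(** [G] enters only through [W *m G = diagK K], so every solution [G] gives the same closed loop. *)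
Lemma system_traj_closed_dbr (W : 'M[R]_(m + (n + n), T)) (X : 'M[R]_(n, T))
    (G : 'M[R]_(T, n + (n + n))) (K : 'M[R]_(m, n)) (i j : nat)
    (x : int -> 'cV[R]_n) :
  diagK K = W *m G -> X = row_mx B (row_mx A1 A0) *m W ->
  system_traj A0 A1 B j i x (fun k => K *m x k) <-> closed_loop_dbr X G i j x.
Proof.
move=> KG ->; split=> tr k; move: (tr k);
by rewrite system_stepE -(mulmxA _ W) -KG -mulmxA diagK_stack3.
Qed.

(** The top block row of [W0 *m G = diagK K] reads [[K 0 0]]; this justifies the data-based formula
    for the input. *)
Lemma feedback_gainE (x : int -> 'cV[R]_n) (u : int -> 'cV[R]_m) (i j : nat)
    (K : 'M[R]_(m, n)) (G : 'M[R]_(T, n + (n + n))) :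
  diagK K = W0 T x u i j *m G ->
  data_mx T u (- i%:Z) *m G *m stack3 1%:M 0 0 = K.
Proof.
move=> KG.
have : diagK K *m stack3 1%:M 0 0 = W0 T x u i j *m G *m stack3 1%:M 0 0.
  by rewrite KG.
rewrite diagK_stack3 mulmx1 /W0 /stack3 !mul_col_mx.
by case/eq_col_mx.
Qed.

End DelaySystem.

(** * Identification of the delays by the test *)

Theorem proposition5p2 (R : realType) (n m T hbar : nat)
    (hbar_gt0 : (0 < hbar)%N) (hbar_ltT : (hbar < T)%N)
    (A0 A1 : 'M[R]_n) (B : 'M[R]_(n, m)) (h1 h2 : 'I_hbar.+1)
    (x xnom xd : int -> 'cV[R]_n) (u unom ud : int -> 'cV[R]_m)
    (x_dec : forall k : int, - hbar%:Z <= k <= T%:Z -> x k = xnom k + xd k)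
    (u_dec : forall k : int, - hbar%:Z <= k <= T%:Z -> u k = unom k + ud k)
    (nom_dyn : forall k : nat, (k < T)%N ->
       system_step A0 A1 B h1 h2 xnom unom k%:Z)
    (P : rel 'I_hbar.+1) (true_pair_in : P h2 h1)
    (rankW : forall i j : 'I_hbar.+1, P i j ->
       \rank (W0 T x u i j) = (m + 2 * n)%N)
    (rankWnom : forall i j : 'I_hbar.+1, P i j ->
       \rank (W0 T xnom unom i j) = (m + 2 * n)%N)
    (U : 'I_hbar.+1 -> 'I_hbar.+1 -> 'M[R]_(m + (n + n)))
    (V : 'I_hbar.+1 -> 'I_hbar.+1 ->
       'M[R]_(T, (m + (n + n)) + (T - (m + (n + n)))))
    (UV_adapted : forall i j : 'I_hbar.+1, P i j ->
       adapted (W0 T x u i j) (U i j) (V i j))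
    (small : forall i j : 'I_hbar.+1, P i j ->
       opnorm2 (blk11 (U i j) (V i j) (W0 T xd ud i j))
         * opnorm2 (mpinv (W0 T x u i j)) < 1)
    (rX : R) (r11 r12 : 'I_hbar.+1 -> 'I_hbar.+1 -> R)
    (rX_gt0 : 0 < rX)
    (r11_gt0 : forall i j : 'I_hbar.+1, P i j -> 0 < r11 i j)
    (r12_gt0 : forall i j : 'I_hbar.+1, P i j -> 0 < r12 i j)
    (rX_bound : opnorm2 (data_mx T xd 1) <= rX)
    (r12_bound : forall i j : 'I_hbar.+1, P i j ->
       opnorm2 (blk12 (U i j) (V i j) (W0 T xd ud i j)) <= r12 i j)
    (r11_bound : forall i j : 'I_hbar.+1, P i j ->
       opnorm2 (blk11 (U i j) (V i j) (W0 T xd ud i j))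
           * opnorm2 (mpinv (W0 T x u i j))
         <= r11 i j * opnorm2 (mpinv (W0 T x u i j)) < 1) :
  let C := candidate T P x u rX r11 r12 in
  let X1 := data_mx T x 1 in
  (forall istar jstar : 'I_hbar.+1, only_candidate C istar jstar ->
     [/\ h1 = jstar, h2 = istar,
       (* open loop *)
       forall (xs : int -> 'cV[R]_n) (us : int -> 'cV[R]_m),
         (open_loop_dbr X1 (W0 T x u h2 h1) h2 h1 xs us
            <-> open_loop_dbr X1 (W0 T x u istar jstar) istar jstar xs us) /\
         (system_traj A0 A1 B h1 h2 xs us
            <-> open_loop_dbr (X1 - noise_residual T A0 A1 B xd ud istar jstar)
                  (W0 T x u istar jstar) istar jstar xs us)
     & (* closed loop *)
       forall K : 'M[R]_(m, n),
         (exists G : 'M[R]_(T, n + (n + n)), diagK K = W0 T x u istar jstar *m G) /\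
         forall G : 'M[R]_(T, n + (n + n)), diagK K = W0 T x u istar jstar *m G ->
           let KG := data_mx T u (- istar%:Z) *m G *m stack3 1%:M 0 0 in
           diagK K = W0 T x u h2 h1 *m G /\
           forall xs : int -> 'cV[R]_n,
             [/\ forall k : int, K *m xs k = KG *m xs k,
                 closed_loop_dbr X1 G h2 h1 xs
                   <-> closed_loop_dbr X1 G istar jstar xs
               & system_traj A0 A1 B h1 h2 xs (fun k => K *m xs k)
                   <-> closed_loop_dbr
                         (X1 - noise_residual T A0 A1 B xd ud istar jstar)
                         G istar jstar xs]]) /\
  ((exists i j i' j' : 'I_hbar.+1, [/\ C i j, C i' j' & (i, j) <> (i', j')]) ->
     [/\ C h2 h1,
         exists i j : 'I_hbar.+1, C i j /\ (i, j) <> (h2, h1)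
       & ~ exists i j : 'I_hbar.+1, only_candidate C i j]).

Proof.
move=> C X1; pose M := row_mx B (row_mx A1 A0).
have WE := W0D h2 h1 x_dec u_dec.
have X1E : X1 = data_mx T xnom 1 + data_mx T xd 1.
  by apply: data_mxD => c cT; apply: x_dec; lia.
have nomE := data_mx_step nom_dyn.
have freeW : row_free (W0 T x u h2 h1).
  by rewrite /row_free rankW // mul2n addnn.
(* At the true delays the nominal data satisfy the system equation, so [X1] is [M] times the nominal
   [W0] plus noise, as [ddist_le] requires. *)
have Ctrue : C h2 h1.
  have r12_ge0 := ltW (r12_gt0 _ _ true_pair_in).
  have X1M : X1 = M *m (W0 T x u h2 h1 - W0 T xd ud h2 h1) + data_mx T xd 1.
    by rewrite X1E nomE WE addrK.
  rewrite /C /candidate true_pair_in; apply: ddist_le X1M rX_bound _ _ => //.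
  - exact: UV_adapted.
  - exact: r12_bound.
  - exact: r11_bound.
(* Subtracting the residual makes the relation with the noisy [W0] exact, so the representations can
   be compared with the true system. *)
have X1res : X1 - noise_residual T A0 A1 B xd ud h2 h1 = M *m W0 T x u h2 h1.
  by rewrite /noise_residual X1E nomE WE mulmxDr opprB addrA addrAC addrK.
split=> [i j [Cij uniqC]|[i [j [i' [j' [Cij Cij' neq]]]]]].
  (* The true pair is a candidate, hence it is the unique one; after this rewriting the comparisons
     between the two index pairs are trivial. *)
  have [ei ej] := uniqC _ _ Ctrue; rewrite -ei -ej; split=> // [xs us|K].
    by split=> //; exact: system_traj_dbr.
  split=> [|G KG /=].
    by exists (mpinv (W0 T x u h2 h1) *m diagK K);
      rewrite mulmxA mulmx_mpinv ?mul1mx.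
  split=> // xs; split=> //; first by rewrite (feedback_gainE KG).
  exact: system_traj_closed_dbr KG X1res.
split=> //.
(* Of two distinct candidates, at least one differs from the true pair. *)
- have [e|ne] := pselect ((i, j) = (h2, h1)); last by exists i, j.
  by exists i', j'; split=> // e'; apply: neq; rewrite e e'.
- move=> [k [l [_ uniqC]]]; apply: neq.
  by have [-> ->] := uniqC _ _ Cij; have [-> ->] := uniqC _ _ Cij'.
Qed.
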